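(* $(G_M,\hat{\boxtimes},\mathbf e)$ is a hyper group, where $G_M=\bigcup_{m\ge1}\bigcup_{n\ge1}G_{m\times n}$, the product of $A=I_{m\times n}+A_0\in G_{m\times n}$ and $B=I_{p\times q}+B_0\in G_{p\times q}$, with $s=\mathrm{lcm}(m,p)$ and $t=\mathrm{lcm}(n,q)$, is $$A\hat{\boxtimes}B:=I_{s\times t}+A_0\otimes E_{s/m\times t/n}+B_0\otimes E_{s/p\times t/q}+A_0\hat{\boxtimes}B_0,$$ and $\mathbf e=\{I_{m\times n}: m,n\ge 1\}$ is indexed by $\{(m,n)\}$, pairs of positive integers ordered by componentwise divisibility.
   Context: $\mathcal M_{m\times n}$ is the set of real $m\times n$ matrices, $\otimes$ the Kronecker product, $E_n=\frac1{\sqrt n}(1,\dots,1)^T\in\mathbb R^n$, $E_{m\times n}=E_mE_n^T$. For $X\in\mathcal M_{a\times b}$, $Y\in\mathcal M_{c\times d}$, $r=\mathrm{lcm}(b,c)$: $X\boxtimes Y:=(X\otimes E_{r/b}^{T})(Y\otimes E_{r/c})$. For $A_0\in\mathcal M_{m\times n}$, $B_0\in\mathcal M_{p\times q}$, $s=\mathrm{lcm}(m,p)$, $t=\mathrm{lcm}(n,q)$: $A_0\hat{\boxtimes}B_0:=(A_0\otimes E_{s/m\times t/n})\boxtimes(B_0\otimes E_{s/p\times t/q})\in\mathcal M_{s\times t}$; when both are $m\times n$ this is $A_0\boxtimes B_0$. $I_{m\times n}$ is a formal identity adjoined to the ring $(\mathcal M_{m\times n},+,\boxtimes)$; products of expressions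 are $(aI_{m\times n}+A_0)\boxtimes(bI_{m\times n}+B_0)=abI_{m\times n}+aB_0+bA_0+A_0\boxtimes B_0$. An expression $A=I_{m\times n}+A_0$ is invertible if there is $B=I_{m\times n}+B_0$, $B_0\in\mathcal M_{m\times n}$, with $A\boxtimes B=B\boxtimes A=I_{m\times n}$. $G_{m\times n}:=\{I_{m\times n}+A_0: A_0\in\mathcal M_{m\times n},\ I_{m\times n}+A_0\text{ invertible}\}$; for an element of $G_{m\times n}$ the part $A_0$ is uniquely determined. Hyper group: Let $(G,* )$ be a semigroup. A subset $\mathbf e\subset G$ is an identity set if (i) $g*e=e*g$ for all $g\in G$, $e\in\mathbf e$; (ii) $\mathbf e=\{e_\lambda:\lambda\in\Lambda\}$ is indexed without repetition by a lattice $(\Lambda,\le)$ and $e_\lambda*e_\mu=e_{\lambda\vee\mu}$; (iii) for each $g\in G$ there is a unique $e_g=e_{\lambda_g}\in\mathbf e$ such that for all $\lambda\in\Lambda$: $e_\lambda*g=g$ if and only if $\lambda\le\lambda_g$. A hyper group $(G,*,\mathbf e)$ is a semigroup with an identity set such that for each $g\in G$ there is $g^{-1}\in G$ with $g*g^{-1}=g^{-1}*g=e_g$. *)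

(* Defs.v *)
From HB Require Import structures.
From mathcomp Require Import all_boot all_order all_algebra.
From mathcomp Require Import boolp classical_sets reals mxtens.

Set Implicit Arguments.
Unset Strict Implicit.
Unset Printing Implicit Defensive.

Import Order.TTheory GRing.Theory Num.Theory.

(* A structure on a subset [G] of an ambient type [T]; nothing is required of
   [op] outside [G]. *)
Section HyperGroup.
Local Open Scope classical_set_scope.
Local Open Scope order_scope.
Context {T : Type} (G : set T) (op : T -> T -> T).

Record is_semigroup : Prop := IsSemigroup {
  semigroup_closed : forall g h, G g -> G h -> G (op g h);
  semigroup_assoc : forall g h k, G g -> G h -> G k ->
    op g (op h k) = op (op g h) k }.

Context (E : set T) {disp : Order.disp_t} {L : latticeType disp} (e : L -> T).

(* [e l] is the element written e_g in the definition of an identity set. *)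
Definition is_identity_of (g : T) (l : L) : Prop :=
  forall k : L, op (e k) g = g <-> k <= l.

Record is_identity_set : Prop := IsIdentitySet {
  identity_sub : E `<=` G;
  identity_range : E = range e;
  identity_inj : injective e;
  identity_central : forall g x, G g -> E x -> op g x = op x g;
  identity_join : forall l k, op (e l) (e k) = e (l `|` k);
  identity_unique : forall g, G g -> exists! l : L, is_identity_of g l }.

Record is_hyper_group : Prop := IsHyperGroup {
  hyper_semigroup : is_semigroup;
  hyper_identity : is_identity_set;
  hyper_inverse : forall g, G g -> exists2 h, G h &
    exists l : L, [/\ is_identity_of g l, op g h = e l & op h g = e l] }.

End HyperGroup.

(* Positive integers under divisibility: a sublattice of [natdvd], in which
   the excluded 0 is the top element. *)
Definition posn : {pred natdvd} := fun n => (0 < n)%N.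

Lemma posn_meet : {in posn &, forall m n : natdvd, (Order.meet m n) \in posn}.
Proof. by move=> m n; rewrite !unfold_in /= => m0 n0; rewrite gcdn_gt0 m0. Qed.

Lemma posn_join : {in posn &, forall m n : natdvd, (Order.join m n) \in posn}.
Proof.
by move=> m n; rewrite !unfold_in /= => m0 n0; rewrite lcmn_gt0; apply/andP.
Qed.

Record posdvd := PosDvd { posdvd_val : natdvd; _ : posdvd_val \in posn }.

HB.instance Definition _ := [isSub for posdvd_val].
HB.instance Definition _ := [Choice of posdvd by <:].
HB.instance Definition _ :=
  Order.SubChoice_isSubLattice.Build _ natdvd posn Order.dvd_display posdvd
    posn_meet posn_join.

(* [*p] carries the product order, here componentwise divisibility. *)
Notation dims := (posdvd *p posdvd)%type.

Section SemiTensorProduct.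
Local Open Scope ring_scope.
Local Open Scope classical_set_scope.
Context {R : realType}.

Definition Evec (n : nat) : 'cV[R]_n := const_mx (Num.sqrt n%:R)^-1.

Definition Emx (m n : nat) : 'M[R]_(m, n) := Evec m *m (Evec n)^T.

Lemma muln_div_dvd (m s : nat) : (m %| s)%N -> (m * (s %/ m))%N = s.
Proof. by move=> ms; rewrite mulnC divnK. Qed.

(* [castmx] only identifies the formats a * 1 = a and b * (r / b) = r. *)
Definition boxtimes (a b c d : nat) (X : 'M[R]_(a, b)) (Y : 'M[R]_(c, d)) :
    'M[R]_(a, d) :=
  castmx (muln1 a, muln_div_dvd (dvdn_lcml b c))
    (X *t (Evec (lcmn b c %/ b))^T) *m
  castmx (muln_div_dvd (dvdn_lcmr b c), muln1 d)
    (Y *t Evec (lcmn b c %/ c)).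

(* A (x) E_{s/m x t/n}, as an s x t matrix *)
Definition stretch (m n s t : nat) (ms : (m %| s)%N) (nt : (n %| t)%N)
    (A : 'M[R]_(m, n)) : 'M[R]_(s, t) :=
  castmx (muln_div_dvd ms, muln_div_dvd nt) (A *t Emx (s %/ m) (t %/ n)).

Definition hat_boxtimes (m n p q : nat) (A : 'M[R]_(m, n)) (B : 'M[R]_(p, q)) :
    'M[R]_(lcmn m p, lcmn n q) :=
  boxtimes (stretch (dvdn_lcml m p) (dvdn_lcml n q) A)
           (stretch (dvdn_lcmr m p) (dvdn_lcmr n q) B).

(* [Expr a A0] is the formal expression a I_{m x n} + A0. *)
Record expr (m n : nat) := Expr { coefI : R; mxpart : 'M[R]_(m, n) }.

Definition expr_mul (m n : nat) (A B : expr m n) : expr m n :=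
  Expr (coefI A * coefI B)
       (coefI A *: mxpart B + coefI B *: mxpart A
        + boxtimes (mxpart A) (mxpart B)).

Definition Iplus (m n : nat) (A0 : 'M[R]_(m, n)) : expr m n := Expr 1 A0.

Definition Iexpr (m n : nat) : expr m n := Expr 1 0.

Definition invertible (m n : nat) (A : expr m n) : Prop :=
  exists B0 : 'M[R]_(m, n),
    expr_mul A (Iplus B0) = Iexpr m n /\ expr_mul (Iplus B0) A = Iexpr m n.

Definition Gmn (m n : nat) : set (expr m n) :=
  [set A | exists2 A0 : 'M[R]_(m, n), A = Iplus A0 & invertible A].

(* expressions of all formats together *)
Definition gexpr : Type := {d : nat * nat & expr d.1 d.2}.

Definition gexpr_of (m n : nat) (A : expr m n) : gexpr :=
  existT (fun d : nat * nat => expr d.1 d.2) (m, n) A.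

Definition GM : set gexpr :=
  \bigcup_(d in [set d : nat * nat | (0 < d.1)%N /\ (0 < d.2)%N])
    (@gexpr_of d.1 d.2 @` @Gmn d.1 d.2).

(* Both factors are read as I + (matrix part), i.e. with coefficient 1, as is
   the case on [GM]. *)
Definition hat_mul (x y : gexpr) : gexpr :=
  let: existT (m, n) A := x in
  let: existT (p, q) B := y in
  gexpr_of (Iplus
    (stretch (dvdn_lcml m p) (dvdn_lcml n q) (mxpart A)
     + stretch (dvdn_lcmr m p) (dvdn_lcmr n q) (mxpart B)
     + hat_boxtimes (mxpart A) (mxpart B))).

Definition identities : set gexpr :=
  [set x | exists m n : nat, [/\ (0 < m)%N, (0 < n)%N & x = gexpr_of (Iexpr m n)]].

Definition identity_at (l : dims) : gexpr :=
  gexpr_of (Iexpr (val l.1) (val l.2)).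

End SemiTensorProduct.

Arguments expr R m n : clear implicits.
Arguments Iexpr R m n : clear implicits.
Arguments Gmn R m n : clear implicits.
Arguments gexpr R : clear implicits.
Arguments GM R : clear implicits.
Arguments identities R : clear implicits.
Arguments identity_at R l : clear implicits.

(* Main.v *)
Require Import Defs.
From mathcomp Require Import all_boot all_order all_algebra.
From mathcomp Require Import boolp classical_sets reals.
From mathcomp Require Import mxtens.

(** Read a vector of R^m as a step function on [0, 1) with m equal cells,
normalised so that the Euclidean norm is the L^2 norm. When m divides N, the
same function seen on the finer grid of N cells is the image of the vector by
the N x m matrix I_m (x) E_{N/m}, called [refinement m N]. These matrices are
isometries ([refinement_orthonormal]) and compose along divisibility
([refinement_trans]). All operations of the statement are expressed by them:
A (x) E_{s/m x t/n} is A conjugated by refinements ([stretchE]), and X [x] Y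
is X followed by Y, where the output grid of one is matched with the input
grid of the other on a common refinement ([boxtimesE]).

Consequently, for any common multiple N > 0 of m and n, the expression I + A0
is an N x N matrix 1 + U_m A0 U_n^T ([oper N A0], with U_m the refinement), in
which U_m A0 U_n^T is the compression of an operator on L^2 that depends
neither on N nor on the format in which A0 is written ([oper_stretch]). The
product of expressions becomes the matrix product ([oper_mul],
[oper_hat_mul]), and for a fixed format [oper N] is injective ([oper_inj]).
So an element of G_M is its format together with an invertible matrix: the
formats multiply by componentwise lcm, the matrices multiply associatively,
and the identities I_{m x n} are the elements with matrix 1. The axioms of a
hyper group are then those of the semilattice of formats combined with those
of a group of matrices; the identity attached to an element is the one of the
same format, since I_{p x q} fixes it exactly when the lcm of the formats is
its own format, i.e. when p | m and q | n. *)

Set Implicit Arguments.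
Unset Strict Implicit.
Unset Printing Implicit Defensive.

Import Order.TTheory GRing.Theory Num.Theory.

Local Open Scope ring_scope.
Local Open Scope classical_set_scope.

(** Provides the common grid on which all factors of an identity are compared. *)
Lemma common_multiple (s : seq nat) : all (leq 1) s ->
  exists2 N, (0 < N)%N & all (dvdn^~ N) s.
Proof.
elim: s => [|d s IHs] /=; first by exists 1.
case/andP=> d0 /IHs[N N0 sN]; exists (d * N)%N; first by rewrite muln_gt0 d0.
by rewrite dvdn_mulr //=; apply: sub_all sN => k; apply: dvdn_mull.
Qed.

(** * Refinement of step functions *)

Section Refinement.
Context {R : realType}.

(** The entries of the unit vector E_d. *)
Definition enorm (d : nat) : R := (Num.sqrt d%:R)^-1.

(** I_m (x) E_{N/m}, given by its entries so that neither a proof that m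
divides N nor a cast of dimensions occurs in the term. *)
Definition refinement (m N : nat) : 'M[R]_(N, m) :=
  \matrix_(i, j) (enorm (N %/ m) *+ (i %/ (N %/ m) == j)%N).

Lemma block_subproof (m N : nat) (mN : (m %| N)%N) (i : 'I_N) :
  (i %/ (N %/ m) < m)%N.
Proof.
have N0 : (0 < N)%N := leq_ltn_trans (leq0n i) (ltn_ord i).
have m0 := dvdn_gt0 N0 mN.
by rewrite ltn_divLR ?(muln_div_dvd mN) // divn_gt0 // dvdn_leq.
Qed.

(** The cell of the coarse grid that contains the i-th cell of the fine one. *)
Definition block (m N : nat) (mN : (m %| N)%N) (i : 'I_N) : 'I_m :=
  Ordinal (block_subproof mN i).

Lemma mul_refinement (m N n : nat) (mN : (m %| N)%N) (X : 'M[R]_(m, n)) i k :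
  (refinement m N *m X) i k = enorm (N %/ m) * X (block mN i) k.
Proof.
rewrite mxE (bigD1 (block mN i)) //= mxE eqxx mulr1n big1 ?addr0 // => j ji.
have /negPf iNj : (i %/ (N %/ m))%N != j.
  by apply: contra ji => /eqP ij; apply/eqP/val_inj.
by rewrite mxE iNj mulr0n mul0r.
Qed.

Lemma mul_refinementT (n N m : nat) (nN : (n %| N)%N) (X : 'M[R]_(m, n)) i k :
  (X *m (refinement n N)^T) i k = X i (block nN k) * enorm (N %/ n).
Proof.
have -> : X *m (refinement n N)^T = (refinement n N *m X^T)^T.
  by rewrite trmx_mul trmxK.
by rewrite mxE (mul_refinement nN) mxE mulrC.
Qed.

Lemma enorm_sum (d : nat) : (0 < d)%N -> \sum_(i < d) enorm d * enorm d = 1.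
Proof.
move=> d0; rewrite sumr_const card_ord -mulr_natl /enorm -invfM -expr2.
by rewrite sqr_sqrtr ?ler0n // divff // pnatr_eq0 -lt0n.
Qed.

(** Distinct columns have disjoint supports, namely the N / m fine cells inside
a coarse one, and on its support each column is the unit vector E_{N/m}. *)
Lemma refinement_orthonormal (m N : nat) : (m %| N)%N -> (0 < N)%N ->
  (refinement m N)^T *m refinement m N = 1%:M.
Proof.
case/dvdnP => d ->; rewrite mulnC muln_gt0 => /andP[m0 d0].
apply/matrixP => j k; rewrite mxE [RHS]mxE.
(* A row index of the fine grid is a pair: coarse cell a, position b in it. *)
rewrite (reindex (@mxtens_index m d)) /=; last first.
  by exists (@mxtens_unindex m d) => i _; rewrite (mxtens_indexK, mxtens_unindexK).
transitivity (\sum_(a < m) \sum_(b < d)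
    refinement m (m * d) (mxtens_index (a, b)) j *
    refinement m (m * d) (mxtens_index (a, b)) k).
  by rewrite pair_bigA; apply: eq_bigr => -[a b] _; rewrite [X in X * _]mxE.
rewrite (bigD1 j) //= [X in _ + X]big1 ?addr0 => [|a aj]; last first.
  apply: big1 => b _; rewrite !mxE /= mulKn // divnMDl // divn_small ?addn0 //.
  by move/negPf: aj; rewrite -val_eqE /= => ->; rewrite mulr0n mul0r.
transitivity (\sum_(b < d) (enorm d * enorm d) *+ (j == k)).
  apply: eq_bigr => b _; rewrite !mxE /= mulKn // divnMDl // divn_small ?addn0 //.
  by rewrite eqxx mulr1n mulrnAr -val_eqE.
by rewrite sumrMnl enorm_sum.
Qed.

(** Subdividing twice is subdividing once: the blocks nest, and the norms of
E_{N/m} and E_{m/l} multiply. *)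
Lemma refinement_trans (l m N : nat) : (l %| m)%N -> (m %| N)%N -> (0 < N)%N ->
  refinement m N *m refinement l m = refinement l N.
Proof.
move=> lm mN N0; have m0 := dvdn_gt0 N0 mN; have l0 := dvdn_gt0 m0 lm.
have Nl : (N %/ l = N %/ m * (m %/ l))%N by rewrite muln_divA // divnK.
apply/matrixP => i k; rewrite (mul_refinement mN) !mxE /= Nl divnMA mulrnAr.
by rewrite /enorm natrM sqrtrM ?ler0n // invfM.
Qed.

Lemma stretchE (m n s t : nat) (ms : (m %| s)%N) (nt : (n %| t)%N)
    (A : 'M[R]_(m, n)) :
  stretch ms nt A = refinement m s *m A *m (refinement n t)^T.
Proof.
apply/matrixP => i j; rewrite (mul_refinementT nt) (mul_refinement ms).
rewrite castmxE !mxE big_ord1 !mxE mulrA [enorm _ * _]mulrC; congr (_ * _ * _).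
by congr (A _ _); apply: val_inj.
Qed.

Lemma boxtimesE (a b c d : nat) (X : 'M[R]_(a, b)) (Y : 'M[R]_(c, d)) :
  boxtimes X Y = X *m ((refinement b (lcmn b c))^T *m refinement c (lcmn b c)) *m Y.
Proof.
rewrite /boxtimes !mulmxA -mulmxA; congr (_ *m _); apply/matrixP => i j.
  rewrite (mul_refinementT (dvdn_lcml b c)) castmxE !mxE /=.
  by congr (X _ _ * _); apply: val_inj => //=; rewrite divn1.
rewrite (mul_refinement (dvdn_lcmr b c)) castmxE !mxE /= mulrC.
by congr (_ * Y _ _); apply: val_inj => //=; rewrite divn1.
Qed.

(** * Expressions as square matrices *)

(** The expression I + A acting on step functions with N cells. The term 1 is
the whole identity of size N, not its compression to the coarse grids, so that
the formal identities of all formats have the same image. *)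
Definition oper (N m n : nat) (A : 'M[R]_(m, n)) : 'M[R]_N :=
  1%:M + refinement m N *m A *m (refinement n N)^T.

Lemma oper0 (N m n : nat) : oper N (0 : 'M[R]_(m, n)) = 1%:M.
Proof. by rewrite /oper mulmx0 mul0mx addr0. Qed.

Lemma oper_inj (N m n : nat) : (0 < N)%N -> (m %| N)%N -> (n %| N)%N ->
  injective (@oper N m n).
Proof.
move=> N0 mN nN A B /addrI AB.
have compress (X : 'M[R]_(m, n)) : X = (refinement m N)^T *m
    (refinement m N *m X *m (refinement n N)^T) *m refinement n N.
  rewrite -!mulmxA refinement_orthonormal // mulmx1 mulmxA.
  by rewrite refinement_orthonormal // mul1mx.
by rewrite (compress A) AB -compress.
Qed.

Lemma oper_stretch (N m n s t : nat) (ms : (m %| s)%N) (nt : (n %| t)%N)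
    (A : 'M[R]_(m, n)) : (0 < N)%N -> (s %| N)%N -> (t %| N)%N ->
  oper N (stretch ms nt A) = oper N A.
Proof.
move=> N0 sN tN; congr (_ + _); rewrite stretchE !mulmxA refinement_trans //.
by rewrite -mulmxA -trmx_mul refinement_trans.
Qed.

(** The matrix that sits between X and Y in X [x] Y matches two grids through
their least common refinement; isometry of the further refinements shows that
every common refinement gives the same matrix. *)
Lemma oper_mul (N m n : nat) (A B : 'M[R]_(m, n)) :
  (0 < N)%N -> (m %| N)%N -> (n %| N)%N ->
  oper N (A + B + boxtimes A B) = oper N A *m oper N B.
Proof.
move=> N0 mN nN; have lN : (lcmn n m %| N)%N by rewrite dvdn_lcm nN.
have bridge : (refinement n (lcmn n m))^T *m refinement m (lcmn n m) =
    (refinement n N)^T *m refinement m N.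
  rewrite -(refinement_trans (dvdn_lcml n m) lN N0).
  rewrite -(refinement_trans (dvdn_lcmr n m) lN N0) trmx_mul mulmxA.
  by rewrite -(mulmxA _ _ (refinement _ N)) refinement_orthonormal // mulmx1.
rewrite /oper boxtimesE bridge mulmxDl mul1mx !mulmxDr !mulmxDl !mulmx1 !mulmxA.
by rewrite !addrA; congr (_ + _); rewrite -!addrA; congr (_ + _); rewrite addrC.
Qed.

Lemma oper_hat_mul (N m n p q : nat) (A : 'M[R]_(m, n)) (B : 'M[R]_(p, q)) :
  (0 < N)%N -> [/\ (m %| N)%N, (n %| N)%N, (p %| N)%N & (q %| N)%N] ->
  oper N (stretch (dvdn_lcml m p) (dvdn_lcml n q) A
     + stretch (dvdn_lcmr m p) (dvdn_lcmr n q) B + hat_boxtimes A B) =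
  oper N A *m oper N B.
Proof.
move=> N0 [mN nN pN qN].
by rewrite oper_mul ?oper_stretch // dvdn_lcm (mN, nN).
Qed.

Lemma expr_mul_eq_Iexpr (N m n : nat) (A B : 'M[R]_(m, n)) :
  (0 < N)%N -> (m %| N)%N -> (n %| N)%N ->
  expr_mul (Iplus A) (Iplus B) = Iexpr R m n <-> oper N A *m oper N B = 1%:M.
Proof.
move=> N0 mN nN; rewrite -oper_mul // -(oper0 N m n).
rewrite /expr_mul /= mulr1 !scale1r [B + A]addrC.
by split=> [[->] //|/(oper_inj N0 mN nN) ->].
Qed.

(** How equalities between expressions of provably equal formats are obtained
without casts: the images under [oper N] live in one and the same ring. *)
Lemma gexpr_eq (N m n p q : nat) (A : 'M[R]_(m, n)) (B : 'M[R]_(p, q)) :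
  (0 < N)%N -> (m %| N)%N -> (n %| N)%N -> m = p -> n = q ->
  oper N A = oper N B -> gexpr_of (Iplus A) = gexpr_of (Iplus B).
Proof.
move=> N0 mN nN mp nq; move: mp nq B => <- <- B.
by move=> /(oper_inj N0 mN nN) ->.
Qed.

(** * The semigroup of invertible expressions *)

Lemma GM_intro (N m n : nat) (A B : 'M[R]_(m, n)) :
  (0 < N)%N -> (m %| N)%N -> (n %| N)%N ->
  oper N A *m oper N B = 1%:M -> oper N B *m oper N A = 1%:M ->
  GM R (gexpr_of (Iplus A)).
Proof.
move=> N0 mN nN AB BA; exists (m, n).
  by split; apply: dvdn_gt0; eassumption.
exists (Iplus A) => //; exists A => //; exists B.
by split; apply/(expr_mul_eq_Iexpr _ _ N0 mN nN).
Qed.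

Variant GM_spec : gexpr R -> Prop :=
  GMSpec (m n : nat) (A B : 'M[R]_(m, n)) of (0 < m)%N & (0 < n)%N &
    (forall N, (0 < N)%N -> (m %| N)%N -> (n %| N)%N ->
       oper N A *m oper N B = 1%:M /\ oper N B *m oper N A = 1%:M) :
  GM_spec (gexpr_of (Iplus A)).

Lemma GMP (x : gexpr R) : GM R x -> GM_spec x.
Proof.
case=> [[m n]] /= [m0 n0] [_ [A -> [B [AB BA]]] <-].
by apply: (GMSpec (B := B)) => // N N0 mN nN; split; apply/expr_mul_eq_Iexpr.
Qed.

Lemma GM_identity (m n : nat) : (0 < m)%N -> (0 < n)%N ->
  GM R (gexpr_of (Iexpr R m n)).
Proof.
move=> m0 n0.
have [|N N0 /and3P[mN nN _]] := @common_multiple [:: m; n]; first by rewrite /= m0 n0.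
by apply: (GM_intro (B := 0) N0); rewrite // !oper0 mulmx1.
Qed.

(** The inverse of a product is the product of the inverses in reverse order.
It has to be written in the format of the product itself, so the inverses are
stretched to this format before they are multiplied. *)
Lemma GM_hat_mul (x y : gexpr R) : GM R x -> GM R y -> GM R (hat_mul x y).
Proof.
case/GMP => m n A A' m0 n0 AA'; case/GMP => p q B B' p0 q0 BB'.
have [|N N0 /and5P[mN nN pN qN _]] := @common_multiple [:: m; n; p; q].
  by rewrite /= m0 n0 p0 q0.
have sN : (lcmn m p %| N)%N by rewrite dvdn_lcm mN.
have tN : (lcmn n q %| N)%N by rewrite dvdn_lcm nN.
have [A1 A2] := AA' N N0 mN nN; have [B1 B2] := BB' N N0 pN qN.
pose A'' := stretch (dvdn_lcml m p) (dvdn_lcml n q) A'.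
pose B'' := stretch (dvdn_lcmr m p) (dvdn_lcmr n q) B'.
have CE : oper N (B'' + A'' + boxtimes B'' A'') = oper N B' *m oper N A'.
  by rewrite oper_mul // !oper_stretch.
apply: (GM_intro (B := B'' + A'' + boxtimes B'' A'') N0) => //;
  rewrite CE oper_hat_mul //.
  by rewrite mulmxA -(mulmxA (oper N A)) B1 mulmx1.
by rewrite mulmxA -(mulmxA (oper N B')) A2 mulmx1.
Qed.

Lemma hat_mulA (x y z : gexpr R) : GM R x -> GM R y -> GM R z ->
  hat_mul x (hat_mul y z) = hat_mul (hat_mul x y) z.
Proof.
case/GMP => m n A _ m0 n0 _; case/GMP => p q B _ p0 q0 _.
case/GMP => k l C _ k0 l0 _.
have [|N N0] := @common_multiple [:: m; n; p; q; k; l].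
  by rewrite /= m0 n0 p0 q0 k0 l0.
case/and5P=> mN nN pN qN /and3P[kN lN _].
apply: (gexpr_eq N0); rewrite ?lcmnA // ?dvdn_lcm ?mN ?pN ?kN ?nN ?qN //.
by rewrite !oper_hat_mul ?mulmxA // !dvdn_lcm (mN, pN) (nN, qN) (pN, kN) (qN, lN).
Qed.

(** * Identities and inverses *)

Lemma gexpr_format (m n p q : nat) (A : expr R m n) (B : expr R p q) :
  gexpr_of A = gexpr_of B -> m = p /\ n = q.
Proof. by move=> /(congr1 (@projT1 _ _)) []. Qed.

Lemma hat_mul_identityC (m n p q : nat) (A : 'M[R]_(m, n)) :
  (0 < m)%N -> (0 < n)%N -> (0 < p)%N -> (0 < q)%N ->
  hat_mul (gexpr_of (Iplus A)) (gexpr_of (Iexpr R p q)) =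
  hat_mul (gexpr_of (Iexpr R p q)) (gexpr_of (Iplus A)).
Proof.
move=> m0 n0 p0 q0.
have [|N N0 /and5P[mN nN pN qN _]] := @common_multiple [:: m; n; p; q].
  by rewrite /= m0 n0 p0 q0.
apply: (gexpr_eq N0); rewrite ?dvdn_lcm ?mN ?nN // 1?lcmnC //.
by rewrite !oper_hat_mul // !oper0 mulmx1 mul1mx.
Qed.

Lemma hat_mul_identity (m n p q : nat) :
  hat_mul (gexpr_of (Iexpr R m n)) (gexpr_of (Iexpr R p q)) =
  gexpr_of (Iexpr R (lcmn m p) (lcmn n q)).
Proof.
rewrite /= /hat_boxtimes boxtimesE !stretchE.
by rewrite !(mulmx0, mul0mx) !addr0.
Qed.

(** A product has the lcm of the formats as its format, so an identity whose
format does not divide that of A already fails to fix A by changing it. *)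
Lemma hat_mul_identity_fixed (m n p q : nat) (A : 'M[R]_(m, n)) :
  (0 < m)%N -> (0 < n)%N -> (0 < p)%N -> (0 < q)%N ->
  hat_mul (gexpr_of (Iexpr R p q)) (gexpr_of (Iplus A)) = gexpr_of (Iplus A)
  <-> (p %| m)%N /\ (q %| n)%N.
Proof.
move=> m0 n0 p0 q0; split=> [/gexpr_format [<- <-]|[pm qn]].
  by rewrite !dvdn_lcml.
have [|N N0 /and3P[mN nN _]] := @common_multiple [:: m; n]; first by rewrite /= m0 n0.
have pN := dvdn_trans pm mN; have qN := dvdn_trans qn nN.
apply: (gexpr_eq N0); rewrite ?dvdn_lcm ?mN ?nN ?pN ?qN //.
- by apply/lcmn_idPr.
- by apply/lcmn_idPr.
by rewrite oper_hat_mul // oper0 mul1mx.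
Qed.

Lemma hat_mul_inverse (N m n : nat) (A B : 'M[R]_(m, n)) :
  (0 < N)%N -> (m %| N)%N -> (n %| N)%N -> oper N A *m oper N B = 1%:M ->
  hat_mul (gexpr_of (Iplus A)) (gexpr_of (Iplus B)) = gexpr_of (Iexpr R m n).
Proof.
move=> N0 mN nN AB; apply: (gexpr_eq N0); rewrite ?dvdn_lcm ?mN ?nN //.
- exact/lcmn_idPl.
- exact/lcmn_idPl.
by rewrite oper_hat_mul // AB oper0.
Qed.

End Refinement.

Lemma le_dims (k l : dims) :
  (k <= l)%O <-> (val k.1 %| val l.1)%N /\ (val k.2 %| val l.2)%N.
Proof. by split=> [/andP|[? ?]] //; apply/andP. Qed.

Lemma posdvd_gt0 (k : posdvd) : (0 < val k)%N.
Proof. by case: k. Qed.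

Theorem proposition15p3 (R : realType) :
  is_hyper_group (GM R) hat_mul (identities R) (identity_at R).
Proof.
have identity_of (m n : nat) (m0 : (0 < m)%N) (n0 : (0 < n)%N) (A : 'M[R]_(m, n)) :
    is_identity_of hat_mul (identity_at R) (gexpr_of (Iplus A))
      (PosDvd m0, PosDvd n0).
  move=> k; apply: iff_trans (iff_sym (le_dims _ _)).
  by apply: hat_mul_identity_fixed => //; apply: posdvd_gt0.
split; first by split; [apply: GM_hat_mul | apply: hat_mulA].
- split.
  + by move=> _ [m [n [m0 n0 ->]]]; apply: GM_identity.
  + apply/seteqP; split=> [_ [m [n [m0 n0 ->]]]|_ [k _ <-]].
      by exists (PosDvd m0, PosDvd n0).
    by exists (val k.1), (val k.2); split=> //; apply: posdvd_gt0.
  + move=> [k1 k2] [l1 l2] /gexpr_format /= [kl1 kl2].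
    by congr (_, _); apply: val_inj.
  + move=> _ _ /GMP[m n A _ m0 n0 _] [p [q [p0 q0 ->]]].
    exact: hat_mul_identityC.
  + by move=> k l; apply: hat_mul_identity.
  + move=> _ /GMP[m n A _ m0 n0 _]; exists (PosDvd m0, PosDvd n0); split=> // l Al.
    by apply: le_anti; apply/andP; split; [apply/Al/identity_of | apply/identity_of/Al].
- move=> _ /GMP[m n A B m0 n0 AB].
  have [|N N0 /and3P[mN nN _]] := @common_multiple [:: m; n]; first by rewrite /= m0 n0.
  have [AB1 BA1] := AB _ N0 mN nN.
  exists (gexpr_of (Iplus B)); first exact: GM_intro BA1 AB1.
  exists (PosDvd m0, PosDvd n0).
  by split=> //; apply: (hat_mul_inverse N0).
Qed.
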